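(* Let $F=F(X)$ be the free group on a set $X$ and let ${}^{-}:F\to F$ be the automorphism given by $x\mapsto x^{-1}$ for each $x\in X$. Then for all nontrivial finitely generated subgroups $H,K\leqslant F$, either the pair $H,K$ or the pair $H^{-},K$ satisfies the Hanna Neumann conjecture, i.e. at least one of the following holds: $$\mathrm{rank}(H\cap K)-1\leqslant[\mathrm{rank}(H)-1][\mathrm{rank}(K)-1],$$ $$\mathrm{rank}(H^{-}\cap K)-1\leqslant[\mathrm{rank}(H^{-})-1][\mathrm{rank}(K)-1].$$
   Context: $H^{-}$ denotes the image of $H$ under the automorphism ${}^{-}$ (this is not the set of inverses of elements of $H$). The rank of a free group is the size of a basis; the trivial group has rank $0$. *)

(* Defs.v *)
From HB Require Import structures.
From mathcomp Require Import all_boot all_order all_algebra.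
From mathcomp Require Import boolp classical_sets constructive_ereal.

Set Implicit Arguments.
Unset Strict Implicit.
Unset Printing Implicit Defensive.

Local Open Scope classical_set_scope.
Local Open Scope group_scope.

(* (x, false) is the letter x and (x, true) is the letter x^-1. The type      *)
(* {classic X} is X itself, with the decidable equality given by classical    *)
(* logic, so that X can be an arbitrary set.                                  *)
Notation letter X := ({classic X} * bool)%type.

Section FreeGroup.
Variable X : Type.
Implicit Types (a b : letter X) (u v w : seq (letter X)).

Definition inv_letter a : letter X := (a.1, ~~ a.2).

Definition reduced w := sorted (fun a b => b != inv_letter a) w.

Record free_group := FreeGroup { word : seq (letter X); _ : reduced word }.
HB.instance Definition _ := [isSub for word].
HB.instance Definition _ := [Choice of free_group by <:].

Definition cons_reduce a w :=
  if w is b :: w' then if b == inv_letter a then w' else a :: w else [:: a].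

Definition mul_word u v := foldr cons_reduce v u.
Definition inv_word w := rev (map inv_letter w).

Lemma inv_letterK : involutive inv_letter.
Proof. by case=> x b; rewrite /inv_letter /= negbK. Qed.

Lemma inv_letter_eq a b : (b == inv_letter a) = (a == inv_letter b).
Proof. by apply/eqP/eqP => ->; rewrite inv_letterK. Qed.

Lemma cons_reduce_reduced a w : reduced w -> reduced (cons_reduce a w).
Proof.
case: w => [|b w] //= bw; case: ifP => [_|/negbT ba]; first exact: path_sorted bw.
by rewrite /reduced /= ba.
Qed.

Lemma mul_word_reduced u v : reduced v -> reduced (mul_word u v).
Proof. by move=> rv; elim: u => //= a u; apply: cons_reduce_reduced. Qed.

Lemma inv_word_reduced w : reduced w -> reduced (inv_word w).
Proof.
rewrite /reduced rev_sorted sorted_map; apply: sub_sorted => a b /=.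
by apply: contraNN => /eqP e; rewrite -[b]inv_letterK -e.
Qed.

Lemma cons_reduceK a w :
  reduced w -> cons_reduce a (cons_reduce (inv_letter a) w) = w.
Proof.
case: w => [|b w] /= rw; first by rewrite eqxx.
rewrite inv_letterK; have [eba|ba] := eqVneq b a; last by rewrite /= eqxx.
by case: w rw => [|c w] /= ; rewrite eba // => /andP[/negbTE -> _].
Qed.

Lemma mul_word_cons_reduce a u v :
  reduced v -> mul_word (cons_reduce a u) v = cons_reduce a (mul_word u v).
Proof.
case: u => [|b u] //= rv; have [->|//] := eqVneq b (inv_letter a).
by rewrite cons_reduceK //; apply: mul_word_reduced.
Qed.

Lemma mul_wordA u v w :
  reduced w -> mul_word u (mul_word v w) = mul_word (mul_word u v) w.
Proof.
by move=> rw; elim: u => //= a u ->; rewrite mul_word_cons_reduce.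
Qed.

Lemma mul_word0 w : reduced w -> mul_word w [::] = w.
Proof.
elim: w => //= a w IH rw; rewrite IH; last exact: path_sorted rw.
by case: w {IH} rw => //= b w /andP[/negbTE ->].
Qed.

Lemma mul_inv_word w : reduced w -> mul_word (inv_word w) w = [::].
Proof.
rewrite /inv_word /mul_word; elim: w => //= a w IH rw.
rewrite rev_cons foldr_rcons /= inv_letterK eqxx.
exact: IH (path_sorted rw).
Qed.

Definition fg_one := @FreeGroup [::] isT.
Definition fg_mul (g h : free_group) :=
  FreeGroup (mul_word_reduced (word g) (valP h)).
Definition fg_inv (g : free_group) := FreeGroup (inv_word_reduced (valP g)).

Lemma fg_mulA : associative fg_mul.
Proof. by move=> g h k; apply/val_inj/mul_wordA/(valP k). Qed.

Lemma fg_mul1g : left_id fg_one fg_mul.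
Proof. by move=> g; apply/val_inj. Qed.

Lemma fg_mulg1 : right_id fg_one fg_mul.
Proof. by move=> g; apply/val_inj/mul_word0/(valP g). Qed.

Lemma fg_mulVg : left_inverse fg_one fg_inv fg_mul.
Proof. by move=> g; apply/val_inj/mul_inv_word/(valP g). Qed.

Lemma fg_mulgV : right_inverse fg_one fg_inv fg_mul.
Proof.
move=> g; rewrite -[fg_mul _ _]fg_mul1g -{1}(fg_mulVg (fg_inv g)) -fg_mulA.
by rewrite (fg_mulA _ g) fg_mulVg fg_mul1g fg_mulVg.
Qed.

HB.instance Definition _ := isGroup.Build free_group
  fg_mulA fg_mul1g fg_mulg1 fg_mulVg fg_mulgV.

Definition fg_gen (x : X) : free_group := @FreeGroup [:: (x, false)] isT.

End FreeGroup.

Definition fg_letter (X : Type) (l : letter X) : free_group X :=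
  if l.2 then (fg_gen l.1)^-1 else fg_gen l.1.

Section Lift.
Variables (I : Type) (G : groupType) (b : I -> G).

Definition lift_letter (l : letter I) : G :=
  if l.2 then (b l.1)^-1 else b l.1.

(* The homomorphism from the free group on I to G extending b. *)
Definition fg_lift (w : free_group I) : G :=
  \prod_(l <- word w) lift_letter l.

Lemma lift_inv_letter l : lift_letter (inv_letter l) = (lift_letter l)^-1.
Proof. by case: l => x [] /=; rewrite /lift_letter /= ?invgK. Qed.

Lemma fg_lift_is_multiplicative :
  {morph fg_lift : u v / (u * v)%g >-> (u * v)%g}.
Proof.
move=> [u ru] [v rv]; rewrite /fg_lift /=.
elim: u {ru} => [|a u IH] /=; first by rewrite big_nil mul1g.
rewrite big_cons -mulgA -IH; case: (mul_word u v) => [|c w] /=.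
  by rewrite big_seq1 big_nil mulg1.
have [->|_] := eqVneq c (inv_letter a); last by rewrite big_cons.
by rewrite big_cons lift_inv_letter mulVKg.
Qed.

Lemma fg_lift_is_umagma_morphism : monoid_morphism fg_lift.
Proof. by split; [rewrite /fg_lift big_nil | exact: fg_lift_is_multiplicative]. Qed.

HB.instance Definition _ := isUMagmaMorphism.Build (free_group I) G fg_lift
  fg_lift_is_umagma_morphism.

Lemma fg_lift_gen x : fg_lift (fg_gen x) = b x.
Proof. by rewrite /fg_lift big_seq1. Qed.

Lemma fg_lift_unique (f : free_group I -> G) :
  {morph f : u v / (u * v)%g >-> (u * v)%g} ->
  (forall x, f (fg_gen x) = b x) -> f =1 fg_lift.
Proof.
move=> fM fb; have f1 : f 1 = 1.
  by apply: (mulgI (f 1)); rewrite -fM !mulg1.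
have fV u : f u^-1 = (f u)^-1.
  by apply: (mulgI (f u)); rewrite -fM !mulgV.
case=> w; rewrite /fg_lift /=; elim: w => [|a w IH] rw.
  by rewrite big_nil -[RHS]f1; congr f; apply: val_inj.
have rw' := path_sorted rw; rewrite big_cons -(IH rw').
have -> : FreeGroup rw = fg_letter a * FreeGroup rw'.
  apply: val_inj; case: a {IH} rw => x [] rw /=;
  by case: w rw rw' => //= c w /andP[/negbTE ->].
rewrite fM; congr (_ * _); case: a {IH rw} => x [];
by rewrite /fg_letter /lift_letter /= ?fV fb.
Qed.

End Lift.

Section Bar.
Variable X : Type.

Definition bar : free_group X -> free_group X :=
  fg_lift (fun x => (fg_gen x)^-1).

HB.instance Definition _ := UMagmaMorphism.copy bar
  (fg_lift (fun x : X => (fg_gen x)^-1)).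

Lemma bar_gen x : bar (fg_gen x) = (fg_gen x)^-1.
Proof. exact: fg_lift_gen. Qed.

Lemma barM : {morph bar : u v / (u * v)%g}.
Proof. exact: fg_lift_is_multiplicative. Qed.

Lemma barK : involutive bar.
Proof.
have barV (u : free_group X) : bar u^-1 = (bar u)^-1 by rewrite gmulfV.
have id_lift : id =1 fg_lift (@fg_gen X) by apply: fg_lift_unique.
move=> u; rewrite [RHS]id_lift; apply: (fg_lift_unique (f := bar \o bar)).
  by move=> v w /=; rewrite !barM.
by move=> x /=; rewrite bar_gen barV bar_gen invgK.
Qed.

Lemma bar_bijective : bijective bar.
Proof. by exists bar; apply: barK. Qed.

End Bar.

Arguments bar {X}.

Section Subgroups.
Variable G : groupType.
Implicit Types (H K : set G).

Definition is_subgroup H := group_closed (mem H).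

Definition finitely_generated H :=
  exists s : seq G, H = smallest is_subgroup [set` s].

(* The family b is a basis of the (free) group H: the homomorphism it induces *)
(* from the free group on I is an isomorphism onto H.                         *)
Definition is_basis (I : Type) (b : I -> G) H :=
  injective (fg_lift b) /\ range (fg_lift b) = H.

(* The size of a finite basis of H, and +oo if H has no finite basis. *)
Definition rank H : \bar int :=
  xget +oo%E
    [set r | exists (n : nat) (b : 'I_n -> G), is_basis b H /\ r = n%:Z%:E].

End Subgroups.

(* Main.v *)
Require Import Defs.
From HB Require Import structures.
From mathcomp Require Import all_boot all_order all_algebra.
From mathcomp Require Import boolp classical_sets constructive_ereal.
From mathcomp Require Import zify.

(** Let G be the graph with two vertices p and q, and one edge from p to q for
    each element of X, plus one extra edge. Its fundamental group at p is F(X),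
    x being the loop that crosses the edge x and returns along the extra edge,
    and the automorphism bar is induced by the symmetry of G that exchanges p
    and q. A subgroup H corresponds to a covering of G whose core has p-vertices
    and q-vertices; the excess of a vertex is its valence minus 2, and, [P] and
    [Q] being the sums of the excesses over the vertices of each kind,

      2 (rank H - 1) = P(H) + Q(H).

    The core of the covering for H /\ K embeds in the fibre product of the cores
    for H and K, and a vertex of the fibre product lies over a pair of vertices
    of the same kind. Since its excess is at most the product of the two
    excesses,

      2 (rank (H /\ K) - 1) <= P(H) P(K) + Q(H) Q(K).

    For the image of H under bar the roles of P(H) and Q(H) are exchanged. The
    two upper bounds add up to (P(H) + Q(H)) (P(K) + Q(K)), which is
    4 (rank H - 1) (rank K - 1), so one of them is at most half of this.

    The formalization contracts the lifts of the extra edge, and so works in the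
    Schreier graph of the right cosets H g, with an edge from H g to H (g a) for
    each letter a. The two vertices over a coset are recovered from its numbers
    of outgoing and incoming core edges: the vertex over p has the outgoing
    edges, together with the extra edge if there is an incoming one, and
    symmetrically over q ([source_excess], [sink_excess]).

    An edge is in the core when a cyclically reduced closed path starts with it
    ([core_edge]). With this description the inclusion of the core of H /\ K in
    those of H and K ([core_edgeI]), the effect of a conjugation
    ([conj_core_edge]) and that of bar ([bar_core_edge]) are immediate. The
    rank formula [core_rank] needs a basis. After a conjugation the base point
    lies in the core, and then the core is made of the edges met by the reduced
    words of H ([based_core_edge]). A Schreier transversal
    ([schreier_transversal]) is a maximal tree in the Schreier graph, and the
    edges outside the tree, all of them in the core, give a free basis of H
    ([schreier_basis]); counting edges and vertices gives the formula
    ([basis_of_core]). The core is finite for a finitely generated subgroup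
    ([fg_core_finite]), hence for an intersection of two of them. *)

Set Implicit Arguments.
Unset Strict Implicit.
Unset Printing Implicit Defensive.

Local Open Scope classical_set_scope.
Local Open Scope group_scope.

(** * Subgroups and words *)

Section SubgroupFacts.
Variables (G : groupType) (H : set G).
Hypothesis sH : is_subgroup H.

Lemma sub1 : H 1.
Proof. by case: sH => /set_mem. Qed.

Lemma subM x y : H x -> H y -> H (x * y).
Proof. by move=> /mem_set Hx /mem_set Hy; apply/set_mem/(group_closedM sH). Qed.

Lemma subV x : H x -> H x^-1.
Proof. by move=> /mem_set Hx; apply/set_mem/(group_closedV sH). Qed.

Lemma subMr x y : H y -> H (x * y) = H x.
Proof.
move=> Hy; apply/propext; split=> [Hxy|Hx]; last exact: subM.
by rewrite -[x](mulgK y); apply: subM => //; apply: subV.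
Qed.

Lemma subVE x : H x^-1 = H x.
Proof. by apply/propext; split=> /subV; rewrite ?invgK. Qed.

End SubgroupFacts.

Lemma is_subgroupP (G : groupType) (H : set G) :
  H 1 -> (forall x y, H x -> H y -> H (x * y^-1)) -> is_subgroup H.
Proof.
move=> H1 HD; split; first exact/mem_set.
by move=> x y /set_mem Hx /set_mem Hy; apply/mem_set/HD.
Qed.

Section Lift.
Variables (I : Type) (G : groupType) (b : I -> G).

Lemma fg_lift1 : fg_lift b 1 = 1.
Proof. exact: gmulf1. Qed.

Lemma fg_liftV z : fg_lift b z^-1 = (fg_lift b z)^-1.
Proof. exact: gmulfV. Qed.

End Lift.

Section Words.
Variable X : Type.
Implicit Types (a b : letter X) (u v w : seq (letter X)) (g h : free_group X).

Definition of_word w : free_group X := \prod_(a <- w) fg_letter a.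

Lemma of_word_nil : of_word [::] = 1.
Proof. exact: big_nil. Qed.

Lemma of_word_cons a w : of_word (a :: w) = fg_letter a * of_word w.
Proof. exact: big_cons. Qed.

Lemma of_word_cat u v : of_word (u ++ v) = of_word u * of_word v.
Proof. exact: big_cat. Qed.

Lemma of_word1 a : of_word [:: a] = fg_letter a.
Proof. exact: big_seq1. Qed.

Lemma of_word_rcons w a : of_word (rcons w a) = of_word w * fg_letter a.
Proof. by rewrite -cats1 of_word_cat of_word1. Qed.

Lemma word_fg_letter a : word (fg_letter a) = [:: a].
Proof. by case: a => x []. Qed.

Lemma fg_letterV a : fg_letter (inv_letter a) = (fg_letter a)^-1.
Proof. by case: a => x []; rewrite /fg_letter /= ?invgK. Qed.

Lemma wordM g h : word (g * h) = mul_word (word g) (word h).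
Proof. by []. Qed.

Lemma word_inj : injective (@word X).
Proof. exact: val_inj. Qed.

Lemma word_reduced g : reduced (word g).
Proof. exact: (valP g). Qed.

Lemma of_wordK w : reduced w -> word (of_word w) = w.
Proof.
elim: w => [|a w IH] rw; first by rewrite of_word_nil.
rewrite of_word_cons wordM word_fg_letter IH; last exact: path_sorted rw.
by case: w rw {IH} => //= b w /andP[/negbTE ->].
Qed.

Lemma wordK : cancel (@word X) of_word.
Proof. by move=> g; apply: word_inj; rewrite of_wordK ?word_reduced. Qed.

Lemma of_wordV w : of_word (inv_word w) = (of_word w)^-1.
Proof.
elim: w => [|a w IH]; first by rewrite /inv_word /= of_word_nil invg1.
rewrite /inv_word /= rev_cons of_word_rcons -/(inv_word w) IH of_word_cons.
by rewrite invgM fg_letterV.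
Qed.

Lemma inv_wordK : involutive (@inv_word X).
Proof.
move=> w; rewrite /inv_word map_rev revK -map_comp map_id_in // => a _ /=.
exact: inv_letterK.
Qed.

Lemma inv_word_cat u v : inv_word (u ++ v) = inv_word v ++ inv_word u.
Proof. by rewrite /inv_word map_cat rev_cat. Qed.

Lemma inv_letterN a : inv_letter a != a.
Proof. by case: a => x b; rewrite xpair_eqE /= eqxx; case: b. Qed.

Lemma reduced_cat u a b v :
  reduced (rcons u a ++ b :: v) =
  [&& reduced (rcons u a), reduced (b :: v) & b != inv_letter a].
Proof.
rewrite /reduced; case: u => [|c u] /=; first by rewrite andbC.
by rewrite cat_path last_rcons /= (andbC (b != _)).
Qed.

Lemma reduced_catl u v : reduced (u ++ v) -> reduced u.
Proof. by case: u => //= a u; rewrite /reduced /= cat_path => /andP[]. Qed.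

Lemma reduced_catr u v : reduced (u ++ v) -> reduced v.
Proof.
by case: u => //= a u; rewrite /reduced /= cat_path => /andP[_ /path_sorted].
Qed.

(** Cancellation between two reduced words can only start at the junction. *)
Lemma reduced_cat_or u c w : reduced (rcons u c) -> reduced w ->
  reduced (rcons u c ++ w) \/ exists w', w = inv_letter c :: w'.
Proof.
case: w => [|b w] ru rw; first by left; rewrite cats0.
rewrite reduced_cat ru rw /=; case: eqVneq => [->|_]; [by right; exists w|by left].
Qed.

Lemma reduced_cat_or_r u c w : reduced (rcons u c) -> reduced w ->
  reduced (w ++ inv_word (rcons u c)) \/ exists w', w = rcons w' c.
Proof.
move=> ru rw; case: (reduced_cat_or ru (inv_word_reduced rw)) => [|[w' e]].
  by move/inv_word_reduced; rewrite inv_word_cat inv_wordK; left.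
right; exists (inv_word w'); rewrite -[w]inv_wordK e /inv_word /= rev_cons.
by rewrite inv_letterK.
Qed.

Lemma reduced_cat3 u w v : w != [::] ->
  reduced (u ++ w) -> reduced (w ++ v) -> reduced (u ++ w ++ v).
Proof.
case/lastP: w => // w c _; case: v => [|b v]; first by rewrite !cats0.
rewrite catA -rcons_cat !reduced_cat => -> /and3P[_ -> ->] //.
Qed.

Definition cyc_reduced w := cycle (fun a b => b != inv_letter a) w.

Lemma cyc_reduced_catC u v : cyc_reduced (u ++ v) = cyc_reduced (v ++ u).
Proof. exact: cycle_catC. Qed.

Lemma cyc_reduced_reduced w : cyc_reduced w -> reduced w.
Proof.
by case: w => //= a w; rewrite /cyc_reduced /= rcons_path => /andP[].
Qed.

Lemma cyc_reducedE a w b :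
  cyc_reduced (a :: rcons w b) = reduced (a :: rcons w b) && (a != inv_letter b).
Proof. by rewrite /cyc_reduced /reduced /= rcons_path last_rcons. Qed.

Lemma cyc_reducedV w : cyc_reduced w -> cyc_reduced (inv_word w).
Proof.
rewrite /cyc_reduced rev_cycle cycle_map; apply: sub_cycle => a b /=.
by apply: contraNN => /eqP e; rewrite -[b]inv_letterK -e.
Qed.

(** This alternative drives the inductions on the length of a reduced word: in
    the second case the word is a conjugate of a shorter one. *)
Lemma reduced_cyc w : reduced w ->
  cyc_reduced w \/ exists b w', w = b :: rcons w' (inv_letter b).
Proof.
case: w => [|a w]; first by left.
case/lastP: w => [|w b] rw; first by left; rewrite /cyc_reduced /= eq_sym inv_letterN.
have [ab|ab] := eqVneq a (inv_letter b); last by left; rewrite cyc_reducedE rw ab.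
by right; exists a, w; rewrite ab inv_letterK.
Qed.

End Words.

(** * The Schreier graph of a subgroup and its core *)

Section SchreierGraph.
Variable X : Type.
Implicit Types (a b : letter X) (s t u v w : seq (letter X)) (g h : free_group X).

(** A vertex H g of the Schreier graph is represented by any of its elements g,
    and a pair (g, a) stands for the edge labelled a that leaves H g. A closed
    path at H g is a word in the conjugate of H by g^-1. *)
Definition core_edge (H : set (free_group X)) g a :=
  exists2 w, cyc_reduced (a :: w) & H (g * of_word (a :: w) * g^-1).

(** The passage of a path through an edge is tested on cosets, so that neither
    the origin [g] nor the vertex [h] depends on the representative. *)
Fixpoint traverses (H : set (free_group X)) g w h a : Prop :=
  if w is b :: w' then H (g * h^-1) /\ a = b \/ traverses H (g * fg_letter b) w' h a
  else False.

(** The core relative to the base point: unlike [core_edge], it may have a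
    vertex of degree 1, at the base point. *)
Definition based_edge (H : set (free_group X)) g a :=
  exists w, [/\ reduced w, H (of_word w) & traverses H 1 w g a].

Variable H : set (free_group X).
Hypothesis sH : is_subgroup H.

Lemma core_edge_coset g k a : H (g * k^-1) -> core_edge H k a -> core_edge H g a.
Proof.
move=> Hgk [w cw Hw]; exists w => //.
have -> : g * of_word (a :: w) * g^-1 =
  (g * k^-1) * (k * of_word (a :: w) * k^-1) * (g * k^-1)^-1.
  by rewrite invgM invgK !mulgA !mulgVK.
by apply: subM (subV _ _) => //; apply: subM.
Qed.

Lemma cosetC g k : H (g * k^-1) -> H (k * g^-1).
Proof. by rewrite -(subVE sH) invgM invgK. Qed.

Lemma coset_trans k g h : H (g * k^-1) -> H (k * h^-1) -> H (g * h^-1).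
Proof. by move=> gk kh; rewrite -[g](mulgVK k) -mulgA; apply: subM. Qed.

Lemma coset_mulr z g h : H ((g * z) * (h * z)^-1) = H (g * h^-1).
Proof. by rewrite invgM mulgA mulgK. Qed.

Lemma traverses_coset g g' w h h' a : H (g' * g^-1) -> H (h * h'^-1) ->
  traverses H g w h a -> traverses H g' w h' a.
Proof.
move=> + Hh; elim: w g g' => //= b w IH g g' Hg [[gh ->]|T]; [left|right].
  by split=> //; apply: coset_trans Hh; apply: coset_trans gh.
by apply: IH T; rewrite coset_mulr.
Qed.

Lemma traverses_cat g u w h a : traverses H g (u ++ w) h a <->
  traverses H g u h a \/ traverses H (g * of_word u) w h a.
Proof.
elim: u g => [|b u IH] g /=; first by rewrite of_word_nil mulg1; split; [right|case].
by rewrite IH of_word_cons mulgA; tauto.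
Qed.

Lemma traversesP g w h a : traverses H g w h a <->
  exists s t, w = s ++ a :: t /\ H (g * of_word s * h^-1).
Proof.
split; last by case=> s [t [-> Hs]]; apply/traverses_cat; right; left.
elim: w g => //= b w IH g [[gh ->]|/IH[s [t [-> Hs]]]].
  by exists [::], w; rewrite of_word_nil mulg1.
by exists (b :: s), t; rewrite of_word_cons mulgA.
Qed.

Lemma traverses_inv g w h a : traverses H g w h a ->
  traverses H (g * of_word w) (inv_word w) (h * fg_letter a) (inv_letter a).
Proof.
case/traversesP => s [t [-> Hs]]; apply/traversesP; exists (inv_word t), (inv_word s).
split; first by rewrite -(cat1s a t) !inv_word_cat -catA.
by rewrite of_wordV of_word_cat of_word_cons !mulgA mulgK coset_mulr.
Qed.

Lemma traverses_rot g u w h a : H (g * of_word (u ++ w) * g^-1) ->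
  traverses H g (u ++ w) h a -> traverses H (g * of_word u) (w ++ u) h a.
Proof.
move=> Hg /traverses_cat[T|T]; apply/traverses_cat; [right|by left].
apply: traverses_coset T; last by rewrite mulgV; apply: sub1.
by move: Hg; rewrite of_word_cat !mulgA.
Qed.

Lemma closed_core_edge g w h a : cyc_reduced w ->
  H (g * of_word w * g^-1) -> traverses H g w h a -> core_edge H h a.
Proof.
move=> cw Hw /traversesP[s [t [e Hs]]].
apply: core_edge_coset (cosetC Hs) _; rewrite e in cw Hw.
move: cw; rewrite cyc_reduced_catC => cw; exists (t ++ s) => //.
rewrite of_word_cat in Hw; rewrite -cat_cons of_word_cat invgM.
by rewrite !mulgA mulgK in Hw *.
Qed.

Lemma core_edgeV g a : core_edge H g a ->
  core_edge H (g * fg_letter a) (inv_letter a).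
Proof.
case=> w cw Hw; exists (inv_word w).
  by have := cyc_reducedV cw; rewrite -cat1s inv_word_cat cyc_reduced_catC.
have -> : inv_letter a :: inv_word w = inv_word (rcons w a).
  by rewrite /inv_word map_rcons rev_rcons.
rewrite of_wordV -(subVE sH) !invgM !invgK of_word_rcons !mulgA.
by move: Hw; rewrite of_word_cons !mulgA mulgK.
Qed.

(** A cyclically reduced closed path returns to its origin along an edge other
    than the first one. *)
Lemma core_edge_deg2 g a : core_edge H g a -> exists2 b, b != a & core_edge H g b.
Proof.
case=> w; case/lastP: w => [|w c] cw Hw.
  have cw' := cyc_reducedV cw; exists (inv_letter a); first exact: inv_letterN.
  exists [::] => //; rewrite -[[:: _]]/(inv_word [:: a]).
  by rewrite of_wordV -(subVE sH) !invgM !invgK mulgA.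
have := cw; rewrite cyc_reducedE => /andP[rw ac].
exists (inv_letter c); first by rewrite eq_sym.
have e : inv_letter c :: inv_word (a :: w) = inv_word (a :: rcons w c).
  by rewrite /inv_word /= map_rcons !rev_cons rev_rcons.
exists (inv_word (a :: w)); rewrite e; first exact: cyc_reducedV.
by rewrite of_wordV -(subVE sH) !invgM !invgK mulgA.
Qed.

(** The reduced path [r] leads from the base point to a cyclically reduced
    closed path [w]. If r w r^-1 is not reduced, the last edge of [r] lies on
    [w], and the closed path may start at the other end of that edge, which is
    closer to the base point; this is the induction on [r]. *)
Lemma core_sub_based_path r w h a : reduced r -> cyc_reduced w ->
  H (of_word r * of_word w * (of_word r)^-1) -> traverses H (of_word r) w h a ->
  based_edge H h a.
Proof.
elim/last_ind: r w => [|r c IH] w rr cw.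
  rewrite of_word_nil invg1 mul1g mulg1 => Hw T.
  by exists w; split=> //; exact: cyc_reduced_reduced.
have {}IH := IH _ (reduced_catl (u := r) (v := [:: c]) _).
rewrite cats1 in IH; have {}IH w := IH w rr.
rewrite of_word_rcons => Hw T; have rw := cyc_reduced_reduced cw.
have [red1|[w' e]] := reduced_cat_or rr rw; last first.
  rewrite -cat1s in e; rewrite e in cw Hw T.
  apply: (IH (w' ++ [:: inv_letter c])); first by rewrite cyc_reduced_catC.
    move: Hw; rewrite !of_word_cat of_word1 fg_letterV invgM.
    by rewrite !mulgA mulgK.
  by move: (traverses_rot Hw T); rewrite of_word1 fg_letterV mulgK.
have [red2|[w' e]] := reduced_cat_or_r rr rw; last first.
  rewrite -cats1 in e; rewrite e in cw Hw T.
  apply: (IH ([:: c] ++ w')); first by rewrite cyc_reduced_catC.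
    move: Hw; rewrite !of_word_cat of_word1 invgM.
    by rewrite !mulgA mulgK.
  apply: traverses_coset (traverses_rot Hw T); last by rewrite mulgV; apply: sub1.
  rewrite -(subVE sH); move: Hw; rewrite of_word_cat of_word1 !invgM !invgK.
  by rewrite !mulgA mulgK.
have w0 : w != [::] by case: w T {rw cw Hw red1 red2}.
exists (rcons r c ++ w ++ inv_word (rcons r c)); split.
- exact: reduced_cat3.
- by rewrite !of_word_cat of_wordV of_word_rcons mulgA.
- apply/traverses_cat; right; apply/traverses_cat; left.
  by rewrite mul1g of_word_rcons.
Qed.

Lemma core_sub_based g a : core_edge H g a -> based_edge H g a.
Proof.
case=> w cw Hw; rewrite -[g]wordK in Hw *.
by apply: core_sub_based_path (word_reduced g) cw Hw _; left; rewrite mulgV; split=> //; apply: sub1.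
Qed.

(** Suppose that [w] is not cyclically reduced, so that w = b w' b^-1. If neither
    [u] nor its inverse starts with [b], the path u w is cyclically reduced.
    Otherwise [b] is an edge of the core, the origin can be moved across it, and
    the induction applies to w' there. *)
Lemma reduced_path_core g u w h a : u != [::] -> cyc_reduced u ->
  H (g * of_word u * g^-1) -> reduced w -> H (g * of_word w * g^-1) ->
  traverses H g w h a -> core_edge H h a.
Proof.
have [n] := ubnP (size w); elim: n => // n IH in g u w * => sw u0 cu Hu rw Hw T.
have [cw|[b [w' e]]] := reduced_cyc rw; first exact: closed_core_edge cw Hw T.
(* The case of a closed path starting with [b], whether it is [u] or its inverse. *)
have IHb u' : cyc_reduced (b :: u') -> H (g * of_word (b :: u') * g^-1) ->
    core_edge H h a.
  move=> cu' Hu'; move: T; rewrite e -cat1s -cats1 => /traverses_cat[T|].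
    by apply: closed_core_edge cu' Hu' _; rewrite -cat1s; apply/traverses_cat; left.
  move=> /traverses_cat[T|T].
    apply: (IH (g * of_word [:: b]) (u' ++ [:: b]) w') => //.
    - by move: sw; rewrite e /= size_rcons ltnS => /ltnW.
    - by case: (u').
    - by rewrite cyc_reduced_catC.
    - move: Hu'; rewrite of_word_cons of_word_cat of_word1 invgM !mulgA.
      by rewrite mulgK.
    - move: rw; rewrite e -cat1s -cats1 => /reduced_catr; exact: reduced_catl.
    - move: Hw; rewrite e -cats1 of_word_cons of_word_cat !of_word1 fg_letterV.
      by rewrite invgM !mulgA.
  have Tg : traverses H g [:: b] (h * fg_letter a) (inv_letter a).
    have eb : inv_word [:: inv_letter b] = [:: b] by rewrite /inv_word /= inv_letterK.
    move: (traverses_inv T); rewrite eb of_word1.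
    apply: traverses_coset; last by rewrite mulgV; apply: sub1.
    move: Hw; rewrite e -cats1 of_word_cons of_word_cat !of_word1 !mulgA.
    by rewrite -(subVE sH) !invgM !invgK !mulgA.
  suff /core_edgeV : core_edge H (h * fg_letter a) (inv_letter a).
    by rewrite fg_letterV mulgK inv_letterK.
  by apply: closed_core_edge cu' Hu' _; rewrite -cat1s; apply/traverses_cat; left.
case: u u0 cu Hu => // f u _ cu Hu.
have [fb|fb] := eqVneq f b; first by rewrite fb in cu Hu; apply: IHb cu Hu.
have rb : reduced [:: b] by [].
have [red|[u' e']] := reduced_cat_or_r (u := [::]) (c := inv_letter b) rb (cyc_reduced_reduced cu).
  have cuw : cyc_reduced ((f :: u) ++ w).
    rewrite e -rcons_cons -rcons_cat cyc_reducedE inv_letterK fb andbT.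
    rewrite rcons_cat rcons_cons -cat_cons -[b :: _]cat1s.
    apply: reduced_cat3 => //; last by rewrite e in rw.
    by move: red; rewrite /inv_word /= inv_letterK.
  apply: (@closed_core_edge g _ _ _ cuw).
    rewrite of_word_cat.
    have := subM sH Hu Hw; by rewrite !mulgA mulgVK.
  apply/traverses_cat; right; apply: traverses_coset T; last by rewrite mulgV; apply: sub1.
  done.
apply: (IHb (inv_word u')).
  have := cyc_reducedV cu.
  by rewrite e' /inv_word map_rcons rev_rcons inv_letterK.
move: Hu; rewrite e' of_word_cons of_wordV of_word_rcons fg_letterV.
by rewrite -(subVE sH) !invgM !invgK !mulgA.
Qed.
(** The part of the Schreier graph outside the based core consists of trees
    attached to it, so a reduced path from the base point to a vertex of the
    based core cannot leave it. *)
Lemma path_to_based_vertex g b m h a : based_edge H g b -> reduced m ->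
  H (of_word m * g^-1) -> traverses H 1 m h a -> based_edge H h a.
Proof.
case=> w [rw Hw /traversesP[s [t [e]]]]; rewrite mul1g => Hs.
case/lastP: m => // m c rm Hm T.
rewrite {}e in rw Hw.
have [red|[t' [bc _]]] := reduced_cat_or rm (reduced_catr rw).
  exists (rcons m c ++ b :: t); split=> //; last by apply/traverses_cat; left.
  rewrite of_word_cat -[of_word (b :: t)](mulKg (of_word s)) -of_word_cat mulgA.
  by rewrite subMr //; apply: coset_trans (cosetC Hs).
have [red|[s' es]] := reduced_cat_or rm (inv_word_reduced (reduced_catl rw)).
  exists (rcons m c ++ inv_word s); split=> //; last by apply/traverses_cat; left.
  by rewrite of_word_cat of_wordV; apply: coset_trans (cosetC Hs).
move: rw; rewrite -[s]inv_wordK es /inv_word /= rev_cons inv_letterK reduced_cat bc.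
by rewrite eqxx !andbF.
Qed.

(** * A Schreier transversal *)

Lemma word_mul_letter g c : word (g * fg_letter c) = rcons (word g) c \/
  exists2 s, word g = rcons s (inv_letter c) & word (g * fg_letter c) = s.
Proof.
rewrite -[g]wordK; have := word_reduced g.
case/lastP: (word g) => [|s d] rg.
  by rewrite of_word_nil mul1g word_fg_letter; left.
have rc : reduced [:: c] by [].
have [red|[w' [e _]]] := reduced_cat_or rg rc.
  by rewrite cats1 in red; left; rewrite -of_word_rcons !of_wordK.
right; exists s; first by rewrite of_wordK // e inv_letterK.
rewrite of_word_rcons -[fg_letter c]invgK -fg_letterV e inv_letterK mulgK of_wordK //.
by rewrite -cats1 in rg; apply: reduced_catl rg.
Qed.

Definition coset g : set (free_group X) := [set k | H (k * g^-1)].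

Lemma coset_eq g k : H (g * k^-1) -> coset g = coset k.
Proof.
move=> gk; apply/predeqP => h /=; split=> Hh; first exact: coset_trans gk.
exact: coset_trans (cosetC gk).
Qed.

Definition shortest (c : set (free_group X)) : free_group X :=
  xget 1 [set k | c k /\ forall k', c k' -> size (word k) <= size (word k')].

Definition dist g := size (word (shortest (coset g))).

Lemma shortestP g : H (shortest (coset g) * g^-1) /\
  forall k, H (k * g^-1) -> dist g <= size (word k).
Proof.
suff [k] : exists k, [set k | coset g k /\
    forall k', coset g k' -> size (word k) <= size (word k')] k.
  by move=> /(@xgetI _ 1)[].
pose P n := `[< exists2 k, coset g k & size (word k) = n >].
have exP : exists n, P n.
  exists (size (word g)); apply/asboolP; exists g => //.
  by rewrite /coset /mkset mulgV; apply: sub1.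
case: (ex_minnP exP) => n /asboolP[k ck <-] min; exists k; split=> // k' ck'.
by apply: min; apply/asboolP; exists k'.
Qed.

Lemma dist_eq g k : H (g * k^-1) -> dist g = dist k.
Proof. by move=> gk; rewrite /dist (coset_eq gk). Qed.

(** The last letter of a shortest element of each coset points to the parent of
    the coset, and the recursion follows the parents to the base point. Composing
    the letters met on the way, instead of taking the shortest elements
    themselves, is what makes the transversal closed under prefixes. The first
    argument is the distance to the base point. *)
Fixpoint tree_path n g : free_group X :=
  if n is n'.+1 then
    let k := shortest (coset g) in
    let p := of_word (take n' (word k)) in tree_path n' p * (p^-1 * k)
  else 1.

Lemma tree_path_coset n g k : H (g * k^-1) -> tree_path n g = tree_path n k.
Proof. by case: n => //= n gk; rewrite (coset_eq gk). Qed.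

(** A parent is at distance exactly one less, since one more letter would
    otherwise give too short an element of the coset. Hence no letter cancels
    along the recursion: lengths grow by one at each step. *)
Lemma tree_pathP n g : dist g = n ->
  [/\ H (tree_path n g * g^-1), size (word (tree_path n g)) = n
    & forall s a, word (tree_path n g) = rcons s a ->
        tree_path (dist (of_word s)) (of_word s) = of_word s].
Proof.
elim: n g => [|n IH] g dg.
  have [Hs _] := shortestP g; split=> //=; last by case.
  by move: Hs; rewrite -[shortest _]wordK (size0nil dg) of_word_nil.
have [Hs min] := shortestP g; set k := shortest _ in Hs.
have -> : tree_path n.+1 g = let p := of_word (take n (word k)) in
  tree_path n p * (p^-1 * k) by [].
have sk : size (word k) = n.+1 by [].
move: sk; case/lastP ek: (word k) => [|r c] //; rewrite size_rcons => -[sr].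
have rr : reduced r.
  by have := word_reduced k; rewrite ek -cats1; apply: reduced_catl.
have er : take n (rcons r c) = r by rewrite -cats1 take_cat sr ltnn subnn cats0.
rewrite er; set p := of_word r; cbv zeta.
have kE : k = p * fg_letter c by rewrite -[k]wordK ek of_word_rcons.
have size_mul h d : size (word (h * fg_letter d)) <= (size (word h)).+1.
  case: (word_mul_letter h d) => [->|[s -> ->]]; rewrite size_rcons //.
  by do 2!apply: leqW.
have dp : dist p = n.
  have [Hp minp] := shortestP p; apply/eqP; rewrite eqn_leq; apply/andP; split.
    have := minp p; rewrite mulgV => /(_ (sub1 sH)).
    by rewrite (of_wordK rr) sr.
  rewrite -ltnS -dg; apply: leq_trans (size_mul _ c); apply: min.
  by apply: coset_trans Hs; rewrite kE coset_mulr.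
have [HT sT TT] := IH p dp.
rewrite kE mulKg; set q := tree_path n p in HT sT TT *.
have Hq : H (q * fg_letter c * g^-1).
  by apply: coset_trans Hs; rewrite kE coset_mulr.
have eq : word (q * fg_letter c) = rcons (word q) c.
  case: (word_mul_letter q c) => // -[s qs es]; have := min _ Hq.
  by rewrite dg es -sT qs size_rcons ltnNge leqnSn.
split=> // [|s a]; first by rewrite eq size_rcons sT.
rewrite eq => /rcons_inj[<- _]; rewrite wordK (dist_eq HT) dp.
exact: tree_path_coset.
Qed.

(** A Schreier transversal is a set of coset representatives closed under taking
    prefixes; its paths from the base point form a maximal tree. *)
Lemma schreier_transversal : exists t : free_group X -> free_group X,
  [/\ forall g, H (t g * g^-1), forall g k, H (g * k^-1) -> t g = t k
    & forall g s a, word (t g) = rcons s a -> t (of_word s) = of_word s].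
Proof.
exists (fun g => tree_path (dist g) g); split=> [g|g k gk|g].
- by case: (tree_pathP (erefl (dist g))).
- by rewrite (dist_eq gk); apply: tree_path_coset.
- by case: (tree_pathP (erefl (dist g))).
Qed.
(** * The free basis given by a transversal *)

Section SchreierBasis.
Variable t : free_group X -> free_group X.
Hypothesis t_coset : forall g, H (t g * g^-1).
Hypothesis t_eq : forall g k, H (g * k^-1) -> t g = t k.
Hypothesis t_prefix :
  forall g s a, word (t g) = rcons s a -> t (of_word s) = of_word s.

Lemma t_idem g : t (t g) = t g.
Proof. exact/t_eq/t_coset. Qed.

Lemma t_id_rcons s a :
  t (of_word (rcons s a)) = of_word (rcons s a) -> reduced (rcons s a) ->
  t (of_word s) = of_word s.
Proof. by move=> e r; apply: (@t_prefix (of_word (rcons s a)) s a); rewrite e of_wordK. Qed.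

Lemma t1 : t 1 = 1.
Proof.
suff: forall s, reduced s -> t (of_word s) = of_word s -> t 1 = 1.
  by apply; [exact: word_reduced (t 1) | rewrite wordK t_idem].
elim/last_ind => [_|s a IH rs e]; first by rewrite of_word_nil.
apply: IH; first by rewrite -cats1 in rs; apply: reduced_catl rs.
exact: t_id_rcons e rs.
Qed.

(** The closed path at the base point that follows the tree to the edge [a] at
    [g], crosses it, and returns along the tree. It is trivial exactly when the
    edge is in the tree, and this serves as the definition of the tree. *)
Definition schreier_gen g a := t g * fg_letter a * (t (g * fg_letter a))^-1.

Lemma schreier_gen_sub g a : H (schreier_gen g a).
Proof.
apply: cosetC; apply: coset_trans (t_coset _) _.
by rewrite coset_mulr; apply: cosetC.
Qed.

Lemma schreier_gen_coset g k a : H (g * k^-1) -> schreier_gen g a = schreier_gen k a.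
Proof.
by move=> gk; rewrite /schreier_gen (t_eq gk) (@t_eq (g * _) (k * fg_letter a)) ?coset_mulr.
Qed.

Lemma schreier_genV g a :
  schreier_gen (g * fg_letter a) (inv_letter a) = (schreier_gen g a)^-1.
Proof. by rewrite /schreier_gen fg_letterV mulgK !invgM !invgK mulgA. Qed.

Lemma schreier_gen_tree s a : t (of_word (rcons s a)) = of_word (rcons s a) ->
  reduced (rcons s a) -> schreier_gen (of_word s) a = 1.
Proof.
move=> e r; rewrite /schreier_gen (t_id_rcons e r) -of_word_rcons e.
exact: mulgV.
Qed.

Section Labels.
Variable Y : seq (free_group X * {classic X}).
Hypothesis uniqY : uniq Y.
Hypothesis memY : forall g x, (g, x) \in Y <->
  t g = g /\ schreier_gen g (x, false) <> 1.

Definition basis_elt (i : 'I_(size Y)) : free_group X :=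
  let e := tnth (in_tuple Y) i in schreier_gen e.1 (e.2, false).

Definition pos_label g x : free_group 'I_(size Y) :=
  oapp (@fg_gen 'I_(size Y)) 1 (insub (index (t g, x) Y)).

(** Labels with values in the free group on [Y] make it possible to invert the
    morphism to H: reading them along the path of an element of H at the base
    point expresses this element in the basis. *)
Definition label g a := if a.2 then (pos_label (g * fg_letter a) a.1)^-1
  else pos_label g a.1.

Lemma label_coset g k a : H (g * k^-1) -> label g a = label k a.
Proof.
move=> gk; rewrite /label /pos_label (t_eq gk).
by rewrite (@t_eq (g * _) (k * fg_letter a)) ?coset_mulr.
Qed.

Lemma labelV g a : label (g * fg_letter a) (inv_letter a) = (label g a)^-1.
Proof.
case: a => x []; first by rewrite /label invgK.
by rewrite {1}/label fg_letterV mulgK.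
Qed.

Lemma label_basis i : let e := tnth (in_tuple Y) i in
  label e.1 (e.2, false) = fg_gen i.
Proof.
case e : (tnth _ i) => [g x] /=; rewrite /label /= /pos_label.
have eY : (g, x) = nth (g, x) Y i by rewrite -[LHS]e (tnth_nth (g, x)).
have /memY[-> _] : (g, x) \in Y by rewrite eY mem_nth.
by rewrite {1}eY index_uniq // valK.
Qed.

Lemma lift_label g a : fg_lift basis_elt (label g a) = schreier_gen g a.
Proof.
have pos k x : fg_lift basis_elt (pos_label k x) = schreier_gen k (x, false).
  rewrite (schreier_gen_coset _ (cosetC (t_coset k))) /pos_label.
  case: insubP => [i _ iE|]; last rewrite index_mem => kx /=.
    rewrite /= fg_lift_gen /basis_elt (tnth_nth (t k, x)) iE nth_index //.
    by rewrite -index_mem -iE; apply: ltn_ord.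
  rewrite fg_lift1; apply/esym; apply: contrapT => nk.
  by case/negP: kx; apply/memY; rewrite t_idem.
case: a => x []; last exact: pos.
rewrite -[label _ _]/((pos_label (g * fg_letter (x, true)) x)^-1) fg_liftV pos.
by rewrite -[(x, false)]/(inv_letter (x, true)) schreier_genV invgK.
Qed.

Fixpoint path_label g w := if w is a :: w' then
  label g a * path_label (g * fg_letter a) w' else 1.

Lemma path_label_cat g u w :
  path_label g (u ++ w) = path_label g u * path_label (g * of_word u) w.
Proof.
elim: u g => [|a u IH] g; first by rewrite of_word_nil mulg1 mul1g.
by rewrite of_word_cons mulgA /= IH mulgA.
Qed.

Lemma path_label_coset g k w : H (g * k^-1) -> path_label g w = path_label k w.
Proof.
elim: w g k => //= a w IH g k gk.
by rewrite (label_coset _ gk) (@IH (g * _) (k * fg_letter a)) ?coset_mulr.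
Qed.

(** Inverse edges have inverse labels, so that the label of a path does not
    change when the path is reduced. *)
Lemma path_label_cons_reduce g a w :
  path_label g (cons_reduce a w) = path_label g (a :: w).
Proof.
case: w => //= b w; case: eqVneq => [->|//].
by rewrite labelV mulVKg fg_letterV mulgK.
Qed.

Lemma path_label_mul_word g u w :
  path_label g (mul_word u w) = path_label g (u ++ w).
Proof. by elim: u g => //= a u IH g; rewrite path_label_cons_reduce /= IH. Qed.

Definition plabel g h := path_label g (word h).

Lemma plabelM g h k : plabel g (h * k) = plabel g h * plabel (g * h) k.
Proof. by rewrite /plabel wordM path_label_mul_word path_label_cat wordK. Qed.

Lemma plabel1 g : plabel g 1 = 1.
Proof. by []. Qed.

Lemma plabelV g h : plabel g h^-1 = (plabel (g * h^-1) h)^-1.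
Proof.
apply: (mulIg (plabel (g * h^-1) h)); rewrite -plabelM mulVg [RHS]mulVg.
exact: plabel1.
Qed.

Lemma plabel_letter g a : plabel g (fg_letter a) = label g a.
Proof. by rewrite /plabel word_fg_letter /= mulg1. Qed.

(** The contributions of the tree paths at the intermediate vertices cancel. *)
Lemma lift_path_label g w :
  fg_lift basis_elt (path_label g w) = t g * of_word w * (t (g * of_word w))^-1.
Proof.
elim: w g => [|a w IH] g; first by rewrite of_word_nil !mulg1 mulgV fg_lift1.
rewrite [path_label _ _]/= fg_lift_is_multiplicative IH lift_label of_word_cons !mulgA.
by rewrite mulgVK.
Qed.

(** By closure under prefixes, all edges of such a path are in the tree, and so
    carry trivial labels. *)
Lemma plabel_tree g : plabel 1 (t g) = 1.
Proof.
suff: forall s, reduced s -> t (of_word s) = of_word s -> path_label 1 s = 1.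
  by apply; [exact: word_reduced (t g) | rewrite wordK t_idem].
elim/last_ind => [//|s a IH rs e].
have rs' : reduced s by rewrite -cats1 in rs; apply: reduced_catl rs.
rewrite -cats1 path_label_cat (IH rs' (t_id_rcons e rs)) mul1g mul1g /= mulg1.
have tree := schreier_gen_tree e rs.
case: a e rs tree => x [] e rs tree; rewrite /label /pos_label /=.
  rewrite insubN ?invg1 // index_mem; apply/negP => /memY[_]; case.
  rewrite (@schreier_gen_coset _ (of_word s * fg_letter (x, true))) //.
  by have := schreier_genV (of_word s) (x, true); rewrite tree invg1.
rewrite insubN // index_mem; apply/negP => /memY[_]; case.
by rewrite -tree; apply: schreier_gen_coset; apply: t_coset.
Qed.

Lemma plabel_basis_elt i : plabel 1 (basis_elt i) = fg_gen i.
Proof.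
rewrite /basis_elt; have := label_basis i; case e : (tnth _ i) => [g x] /= lab.
have /memY[tg _] : (g, x) \in Y by rewrite -e mem_tnth.
have := schreier_gen_sub g (x, false).
rewrite /schreier_gen tg => Hb.
rewrite !plabelM !mul1g plabelV -{1}tg plabel_tree mul1g plabel_letter lab.
rewrite /plabel (path_label_coset _ (k := 1)); last by rewrite invg1 mulg1.
by rewrite -[path_label _ _]/(plabel 1 (t _)) plabel_tree invg1 mulg1.
Qed.

Lemma lift_sub (I : Type) (b : I -> free_group X) z :
  (forall i, H (b i)) -> H (fg_lift b z).
Proof.
move=> Hb; rewrite /fg_lift; elim: (word z) => [|a w IH].
  by rewrite big_nil; apply: sub1.
rewrite big_cons; apply: subM => //; rewrite /lift_letter; case: ifP => _ //.
exact: subV.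
Qed.

(** The label of paths at the base point is multiplicative on H and sends the
    basis elements to the free generators, whence injectivity; surjectivity is
    [lift_path_label] for a closed path. *)
Lemma schreier_basis : is_basis basis_elt H.
Proof.
have Hb i : H (basis_elt i) by apply: schreier_gen_sub.
have plK : cancel (fg_lift basis_elt) (plabel 1).
  have idE : id =1 fg_lift (@fg_gen 'I_(size Y)) by apply: fg_lift_unique.
  move=> z; rewrite [RHS]idE.
  apply: (fg_lift_unique (f := plabel 1 \o fg_lift basis_elt)) => [u v|i] /=.
    rewrite fg_lift_is_multiplicative plabelM mul1g; congr (_ * _).
    by apply: path_label_coset; rewrite invg1 mulg1; apply: lift_sub.
  by rewrite fg_lift_gen plabel_basis_elt.
split; first exact: can_inj plK.
apply/seteqP; split=> [_ [z _ <-]|h Hh]; first exact: lift_sub.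
exists (plabel 1 h) => //; rewrite lift_path_label wordK mul1g t1 mul1g.
by rewrite (@t_eq h 1) ?t1 ?invg1 ?mulg1.
Qed.

End Labels.

(** * Counting the edges of the core *)

Lemma tree_descent g s a : t g = g -> word g = rcons s (inv_letter a) ->
  schreier_gen g a = 1.
Proof.
move=> tg e; have gE : g = of_word s * fg_letter (inv_letter a).
  by rewrite -of_word_rcons -e wordK.
have ts : t (of_word s) = of_word s by apply: (@t_prefix g s (inv_letter a)); rewrite tg.
by rewrite /schreier_gen tg gE fg_letterV mulgVK ts mulgV.
Qed.

(** Outside the tree, the path that defines [schreier_gen] is reduced: a
    cancellation would put the edge on one of the two tree paths. *)
Lemma nontree_based g a : t g = g -> schreier_gen g a <> 1 -> based_edge H g a.
Proof.
move=> tg nt; exists (word g ++ [:: a] ++ inv_word (word (t (g * fg_letter a)))).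
have rg := word_reduced g; have rt := word_reduced (t (g * fg_letter a)).
have ra : reduced [:: a] by [].
split.
- apply: reduced_cat3 => //.
    case/lastP e : (word g) rg => [|s c] rg //.
    have [//|[w' [ac _]]] := reduced_cat_or rg ra.
    by case: nt; apply: (@tree_descent g s) => //; rewrite ac inv_letterK.
  case/lastP e : (word _) rt => [|s c] rt //.
  have [//|[[|? []//] [ac]]] := reduced_cat_or_r rt ra; case: nt.
  have ts : t (of_word s) = of_word s.
    by apply: (t_prefix (g := g * fg_letter a)); rewrite e.
  have tE : t (g * fg_letter a) = of_word s * fg_letter a.
    by rewrite -[LHS]wordK e of_word_rcons -ac.
  have gs : g = of_word s.
    rewrite -ts -[LHS]tg; apply: t_eq; apply: cosetC.
    by rewrite -(coset_mulr (fg_letter a)) -tE; apply: t_coset.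
  by rewrite /schreier_gen tE -gs tg mulgV.
- rewrite !of_word_cat of_word1 of_wordV !wordK mulgA -{1}tg.
  exact: schreier_gen_sub.
- apply/traverses_cat; right; left; rewrite wordK mul1g mulgV.
  by split=> //; apply: sub1.
Qed.

Section Counting.
Variable u : seq (letter X).
Hypotheses (u0 : u != [::]) (cu : cyc_reduced u) (Hu : H (of_word u)).

Lemma based_core_edge g a : based_edge H g a <-> core_edge H g a.
Proof.
split=> [|]; last exact: core_sub_based.
case=> w [rw Hw T]; apply: (reduced_path_core (g := 1) u0 cu _ rw _ T);
  by rewrite mul1g invg1 mulg1.
Qed.

Variables (V : seq (free_group X)) (D : free_group X -> seq (letter X)).
Hypothesis uniqV : uniq V.
Hypothesis memV : forall g, g \in V <-> t g = g /\ exists a, core_edge H g a.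
Hypothesis uniqD : forall g, uniq (D g).
Hypothesis memD : forall g a, a \in D g <-> core_edge H g a.

Definition edges := [seq (g, a) | g <- V, a <- D g].

Lemma mem_edges g a : (g, a) \in edges <-> t g = g /\ core_edge H g a.
Proof.
split=> [/allpairsPdep[k [b [/memV[tk _] /memD bk [-> ->]]]]//|[tg ga]].
apply/allpairsPdep; exists g, a; split=> //; last exact/memD.
by apply/memV; split=> //; exists a.
Qed.

Lemma uniq_edges : uniq edges.
Proof.
by apply: allpairs_uniq_dep => // -[g a] [k b] _ _ /= [-> ->].
Qed.

Definition rev_edge (e : free_group X * letter X) :=
  (t (e.1 * fg_letter e.2), inv_letter e.2).

Lemma rev_edgeK e : e \in edges -> rev_edge (rev_edge e) = e.
Proof.
case: e => g a /mem_edges[tg _]; rewrite /rev_edge /= inv_letterK; congr pair.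
rewrite -[RHS]tg; apply: t_eq; rewrite fg_letterV -(coset_mulr (fg_letter a)).
by rewrite mulgVK; apply: t_coset.
Qed.

Lemma rev_edge_edges e : e \in edges -> rev_edge e \in edges.
Proof.
case: e => g a /mem_edges[tg ga]; apply/mem_edges; rewrite t_idem; split=> //.
exact: core_edge_coset (t_coset _) (core_edgeV ga).
Qed.

Lemma count_rev_edge (P : pred _) : count (fun e => P (rev_edge e)) edges = count P edges.
Proof.
rewrite -[LHS](count_map rev_edge); apply/permP/uniq_perm; last 1 first.
- move=> e; apply/mapP/idP => [[f fe ->]|ee]; first exact: rev_edge_edges.
  by exists (rev_edge e); [apply: rev_edge_edges | rewrite rev_edgeK].
- rewrite map_inj_in_uniq ?uniq_edges // => e f ee fe ef.
  by rewrite -[e]rev_edgeK // ef rev_edgeK.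
- exact: uniq_edges.
Qed.

Definition tree_edge (e : free_group X * letter X) := schreier_gen e.1 e.2 == 1.
(** The edge leads from a vertex to its parent in the tree. *)
Definition up_edge (e : free_group X * letter X) :=
  size (word (e.1 * fg_letter e.2)) < size (word e.1).

Lemma tree_rev_edge e : tree_edge (rev_edge e) = tree_edge e.
Proof.
rewrite /tree_edge /= (schreier_gen_coset _ (t_coset _)) schreier_genV.
by rewrite invg_eq1.
Qed.

Lemma up_edgeE g a : up_edge (g, a) = (size (word (g * fg_letter a)) < size (word g)).
Proof. by []. Qed.

Lemma up_edgeP g a : up_edge (g, a) -> exists s, word g = rcons s (inv_letter a).
Proof.
rewrite up_edgeE; have [->|[s e _]] := word_mul_letter g a; last by exists s.
by rewrite size_rcons ltnNge leqnSn.
Qed.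

Lemma up_edge_tree e : e \in edges -> up_edge e -> tree_edge e.
Proof.
case: e => g a /mem_edges[tg _] /up_edgeP[s es].
by apply/eqP; apply: tree_descent tg es.
Qed.

Lemma up_rev_edge e : e \in edges -> up_edge (rev_edge e) = tree_edge e && ~~ up_edge e.
Proof.
move=> ee; have [te|nte] := boolP (tree_edge e); last first.
  by apply: contraNF nte => /(up_edge_tree (rev_edge_edges ee)); rewrite tree_rev_edge.
case: e ee te => g a /mem_edges[tg _] /eqP.
rewrite /schreier_gen [(g, a).1]/= [(g, a).2]/= tg => /mulg1_eq/invg_inj/esym e.
rewrite !up_edgeE e fg_letterV mulgK.
by have [->|[s -> ->]] := word_mul_letter g a; rewrite size_rcons ltnSn ltnNge leqnSn.
Qed.

(** Each vertex of the core except the base point has its parent in the core,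
    because the tree path to it does not leave the core. *)
Lemma up_edges_vertices : count up_edge edges = (size V).-1.
Proof.
have V1 : 1 \in V.
  case: u u0 cu Hu => // a w _ cw Hw; apply/memV; rewrite t1; split=> //.
  by exists a; exists w => //; rewrite mul1g invg1 mulg1.
rewrite -size_filter -(size_rem V1) -(size_map fst); apply: perm_size.
apply: uniq_perm; last 1 first.
- move=> g; rewrite mem_rem_uniq // inE; apply/mapP/andP.
    case=> -[k a]; rewrite mem_filter => /andP[/up_edgeP[s es] /mem_edges[tk ka]] ->.
    split; last by apply/memV; split=> //; exists a.
    by apply/eqP => /= k1; move: es; rewrite k1; case: (s).
  case=> g1 /memV[tg [b /core_sub_based gb]].
  case/lastP e : (word g) => [|s c]; first by case/eqP: g1; apply: word_inj.
  have gE : g = of_word s * fg_letter c by rewrite -of_word_rcons -e wordK.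
  exists (g, inv_letter c) => //; rewrite mem_filter; apply/andP; split.
    rewrite up_edgeE e {1}gE fg_letterV mulgK size_rcons of_wordK //.
    by have := word_reduced g; rewrite e -cats1; apply: reduced_catl.
  apply/mem_edges; split=> //; rewrite {1}gE; apply: core_edgeV.
  apply/based_core_edge; apply: (path_to_based_vertex gb (word_reduced g)).
    by rewrite wordK mulgV; apply: sub1.
  rewrite e -cats1; apply/traverses_cat; right; left; split=> //.
  by rewrite mul1g mulgV; apply: sub1.
- rewrite map_inj_in_uniq ?filter_uniq ?uniq_edges // => -[g a] [k b].
  rewrite !mem_filter /= => /andP[/up_edgeP[s es] _] /andP[/up_edgeP[s' es'] _] gk.
  move: es'; rewrite -gk es => /rcons_inj/(congr1 snd).
  by move=> /(can_inj (@inv_letterK X)) ->.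
- exact: rem_uniq.
Qed.

Definition pos_nontree := [seq e <- edges | ~~ tree_edge e && ~~ e.2.2].

(** Reversal pairs the positive edges with the negative ones outside the tree,
    and the ascending edges with the descending ones in it. *)
Lemma size_edges : size edges = (size pos_nontree + (size V).-1).*2.
Proof.
rewrite -(count_predC tree_edge) -up_edges_vertices size_filter.
set T := fun e => _ && _; have -> : count (predC tree_edge) edges = (count T edges).*2.
  rewrite -addnn -[X in _ = X + _]count_rev_edge.
  rewrite -[LHS]size_filter -(count_predC (fun e : free_group X * letter X => e.2.2)).
  rewrite !count_filter; congr (_ + _); apply: eq_count => e /=.
    by rewrite /T tree_rev_edge /= negbK andbC.
  by rewrite /T andbC.
have -> : count tree_edge edges = (count up_edge edges).*2.
  rewrite -addnn -[X in _ = _ + X]count_rev_edge -[LHS]size_filter.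
  rewrite -(count_predC up_edge) !count_filter.
  congr (_ + _); apply: eq_in_count => e ee /=.
    by apply: andb_idr; apply: up_edge_tree.
  by rewrite up_rev_edge // andbC.
by rewrite doubleD addnC.
Qed.

Definition core_basis_edges := [seq (e.1, e.2.1) | e <- pos_nontree].

Lemma core_basis : is_basis (@basis_elt core_basis_edges) H.
Proof.
apply: schreier_basis.
- rewrite map_inj_in_uniq ?filter_uniq ?uniq_edges // => -[g [x b]] [k [y c]].
  by rewrite !mem_filter /= => /andP[/andP[_ /negbTE->] _] /andP[/andP[_ /negbTE->] _] [-> ->].
- move=> g x; split.
    case/mapP => -[k [y b]]; rewrite mem_filter /=.
    move=> /andP[/andP[/eqP nt /negbTE b0] /mem_edges[tk _]] [-> ->].
    by rewrite b0 in nt.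
  case=> tg nt; apply/mapP; exists (g, (x, false)) => //; rewrite mem_filter andbT.
  apply/andP; split; first exact/eqP.
  by apply/mem_edges; split=> //; apply/based_core_edge; apply: nontree_based.
Qed.

(** This is the Euler characteristic of the core, computed as 1 - n with the
    basis and as V - E with the degrees. *)
Lemma basis_of_core : exists n (b : 'I_n -> free_group X),
  is_basis b H /\ \sum_(g <- V) size (D g) + 2 = (n + size V).*2.
Proof.
exists (size core_basis_edges), (@basis_elt core_basis_edges); split; first exact: core_basis.
have -> : \sum_(g <- V) size (D g) = size edges.
  by rewrite size_allpairs_dep sumnE big_map.
rewrite size_edges size_map; have : 0 < size V.
  case: u u0 cu Hu => // a w _ cw Hw; have : 1 \in V; last by case: (V).
  apply/memV; rewrite t1; split=> //.
  by exists a; exists w => //; rewrite mul1g invg1 mulg1.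
case: (size V) => // m _; by rewrite !doubleD doubleS addn2 !addnS.
Qed.

End Counting.
End SchreierBasis.
End SchreierGraph.
(** * The rank, and conjugate subgroups *)

Section Rank.
Variables (G : groupType) (H : set G).

(** A basis of H with m elements gives 2^m morphisms from H to Z/2, and a
    morphism from H is determined by its values on any other basis. *)
Lemma basis_size_le n m (b : 'I_n -> G) (b' : 'I_m -> G) :
  is_basis b H -> is_basis b' H -> m <= n.
Proof.
move=> [_ rb] [inj' rb'].
have /boolp.choice[f fE] i : exists z, fg_lift b' z = b i.
  have : H (b i) by rewrite -rb; exists (fg_gen i) => //; apply: fg_lift_gen.
  by rewrite -rb' => -[z _ <-]; exists z.
have liftE z : fg_lift b' (fg_lift f z) = fg_lift b z.
  apply: (fg_lift_unique (f := fg_lift b' \o fg_lift f)) => [u v|i] /=.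
    by rewrite !fg_lift_is_multiplicative.
  by rewrite fg_lift_gen.
have surj z : exists y, fg_lift f y = z.
  have : H (fg_lift b' z) by rewrite -rb'; exists z.
  by rewrite -rb => -[y _ yz]; exists y; apply: inj'; rewrite liftE.
pose pull (e : {ffun 'I_m -> 'I_2}) := [ffun i => fg_lift e (f i)].
suff /leq_card : injective pull.
  by rewrite !card_ffun !card_ord leq_exp2l.
move=> e1 e2 e12; apply/ffunP => j.
have pullE (e : {ffun 'I_m -> 'I_2}) z : fg_lift e (fg_lift f z) = fg_lift (pull e) z.
  apply: (fg_lift_unique (f := fg_lift e \o fg_lift f)) => [u v|i] /=.
    by rewrite !fg_lift_is_multiplicative.
  by rewrite fg_lift_gen ffunE.
have [y yj] := surj (fg_gen j).
by rewrite -(fg_lift_gen e1 j) -(fg_lift_gen e2 j) -yj !pullE e12.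
Qed.

Lemma rank_basis n (b : 'I_n -> G) : is_basis b H -> rank H = n%:Z%:E.
Proof.
move=> bH; apply: xget_unique; first by exists n, b.
move=> _ [m [b' [b'H ->]]]; congr (_%:Z%:E).
by apply/eqP; rewrite eqn_leq (basis_size_le bH b'H) (basis_size_le b'H bH).
Qed.

End Rank.

Lemma rank_trivial (X : Type) : rank [set (1 : free_group X)] = 0%:Z%:E.
Proof.
apply: (rank_basis (b := fun i : 'I_0 => 1)).
have z1 (z : free_group 'I_0) : z = 1.
  by apply: word_inj; case: (word z) => // -[[]].
split=> [u v _|]; first by rewrite [u]z1 [v]z1.
apply/seteqP; split=> [_ [z _ <-]|_ ->]; first by rewrite [z]z1 fg_lift1.
by exists 1; rewrite ?fg_lift1.
Qed.

Section Conjugation.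
Variables (X : Type) (H : set (free_group X)) (r : free_group X).
Hypothesis sH : is_subgroup H.

Definition conj_sub : set (free_group X) := [set x | H (r * x * r^-1)].

Lemma conj_subgroup : is_subgroup conj_sub.
Proof.
apply: is_subgroupP => [|x y Hx Hy]; rewrite /conj_sub /mkset.
  by rewrite mulg1 mulgV; apply: sub1.
have := subM sH Hx (subV sH Hy); rewrite !invgM invgK !mulgA.
by rewrite mulgVK.
Qed.

Lemma conj_basis n (b : 'I_n -> free_group X) :
  is_basis b conj_sub -> is_basis (fun i => r * b i * r^-1) H.
Proof.
case=> inj rb; have E z : fg_lift (fun i => r * b i * r^-1) z = r * fg_lift b z * r^-1.
  apply/esym; apply: (fg_lift_unique (f := fun z => r * fg_lift b z * r^-1)) => [u v|i].
    by rewrite fg_lift_is_multiplicative !mulgA mulgVK.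
  by rewrite fg_lift_gen.
split=> [u v|]; first by rewrite !E => /mulIg/mulgI/inj.
apply/seteqP; split=> [_ [z _ <-]|h Hh].
  by rewrite E; have : conj_sub (fg_lift b z) by rewrite -rb; exists z.
have : conj_sub (r^-1 * h * r) by rewrite /conj_sub /mkset !mulgA mulgV mul1g mulgK.
rewrite -rb => -[z _ zE]; exists z => //; rewrite E zE !mulgA.
by rewrite mulgV mul1g mulgK.
Qed.

Lemma conj_core_edge g a : core_edge conj_sub g a <-> core_edge H (r * g) a.
Proof.
by split=> -[w cw Hw]; exists w => //; move: Hw;
  rewrite /conj_sub /mkset invgM !mulgA.
Qed.

End Conjugation.

(** * The rank as a sum over the core *)

Section RankFormula.
Variable X : Type.
Implicit Types (H K : set (free_group X)) (g : free_group X) (V : seq (free_group X)).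

(** A nontrivial element of H is a conjugate of a cyclically reduced one, which
    gives a closed path in the core. *)
Lemma exists_core_edge H h : is_subgroup H -> H h -> h <> 1 ->
  exists g a, core_edge H g a.
Proof.
move=> sH Hh h1; suff: forall n g w, size w < n -> reduced w -> w != [::] ->
    H (g * of_word w * g^-1) -> exists g a, core_edge H g a.
  move=> /(_ _ 1 (word h) (ltnSn _) (word_reduced h)); apply.
  - by apply/eqP => e; apply: h1; apply: word_inj.
  - by rewrite mul1g invg1 mulg1 wordK.
elim=> // n IH g w sw rw w0 Hw.
have [cw|[b [w' e]]] := reduced_cyc rw.
  by case: w cw Hw {sw rw w0} (w0) => // a w cw Hw _; exists g, a, w.
apply: (IH (g * fg_letter b) w').
- by move: sw; rewrite e /= size_rcons ltnS => /ltnW.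
- move: rw; rewrite e -cat1s -cats1 => /reduced_catr; exact: reduced_catl.
- by apply/eqP => w'0; move: rw; rewrite e w'0 /= eqxx.
- move: Hw; rewrite e -cats1 of_word_cons of_word_cat !of_word1 fg_letterV.
  by rewrite invgM !mulgA.
Qed.

(** Sums over the vertices of the core are taken along a list of representatives;
    they do not depend on it, the summands being functions of the coset. *)
Definition core_vertices H V :=
  [/\ uniq V, {in V &, forall g k, H (g * k^-1) -> g = k},
      forall g a, core_edge H g a -> exists2 k, k \in V & H (g * k^-1)
    & forall k, k \in V -> exists a, core_edge H k a].

(* An alphabet of the core, so that the degrees can be counted along a list even
   if X is infinite. *)
Variable L : seq {classic X}.
Hypothesis uniqL : uniq L.

Definition degree_out H g := count (fun x => `[< core_edge H g (x, false) >]) L.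
Definition degree_in H g := count (fun x => `[< core_edge H g (x, true) >]) L.

(** The vertex has [p] core edges besides the extra edge, and [q] is the same
    number at the other end of the extra edge. If p > 0, the extra edge is in the
    core exactly when q > 0; if p = 0, the vertex is not in the core, and the
    truncation makes its excess 0. *)
Definition excess p q := (p + (0 < q)) - 2.

Definition source_excess H g := excess (degree_out H g) (degree_in H g).
Definition sink_excess H g := excess (degree_in H g) (degree_out H g).

(** If p and q are positive, both vertices are in the core and the extra edge is
    counted twice; if one of them is zero, neither the extra edge nor one of the
    two vertices is in the core. *)
Lemma excess_degree p q : 1 < p + q -> excess p q + excess q p + 2 = p + q.
Proof.
rewrite /excess; case: p => [|p]; case: q => [|q] /=; lia.
Qed.

Definition core_letters H g : seq (letter X) :=
  [seq a <- [seq (x, false) | x <- L] ++ [seq (x, true) | x <- L] | `[< core_edge H g a >]].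

Lemma size_core_letters H g :
  size (core_letters H g) = degree_out H g + degree_in H g.
Proof. by rewrite size_filter count_cat !count_map. Qed.

Lemma uniq_core_letters H g : uniq (core_letters H g).
Proof.
apply: filter_uniq; rewrite cat_uniq !map_inj_uniq // ?uniqL ?andbT => [|x y []//|x y []//].
by apply/hasPn => _ /mapP[x _ ->]; apply/mapP => -[].
Qed.

Definition covers_core H := forall g a, core_edge H g a -> a.1 \in L.

Lemma mem_core_letters H g a : covers_core H -> a \in core_letters H g <-> core_edge H g a.
Proof.
move=> cov; rewrite mem_filter; split=> [/andP[/asboolP]//|ga].
apply/andP; split; first exact/asboolP.
rewrite mem_cat; case: a ga => x b /cov xL; apply/orP.
by case: b xL => xL; [right|left]; apply/mapP; exists x.
Qed.

Lemma degree_coset H g k : is_subgroup H -> H (g * k^-1) ->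
  degree_out H g = degree_out H k /\ degree_in H g = degree_in H k.
Proof.
move=> sH gk; split; apply: eq_count => x; apply: asbool_equiv_eq;
  by split; apply: core_edge_coset => //; apply: cosetC.
Qed.

Lemma sum_core_degree H V : is_subgroup H -> covers_core H -> core_vertices H V ->
  \sum_(g <- V) (degree_out H g + degree_in H g) =
  \sum_(g <- V) (source_excess H g + sink_excess H g) + (size V).*2.
Proof.
move=> sH cov [_ _ _ Vcore]; rewrite -muln2 -sum1_size big_distrl -big_split /=.
rewrite big_seq [RHS]big_seq; apply: eq_bigr => g /Vcore[a ga].
rewrite mul1n excess_degree // -size_core_letters.
have [b ba gb] := core_edge_deg2 sH ga.
apply: (@uniq_leq_size _ [:: a; b]); first by rewrite /= inE eq_sym ba.
by move=> c; rewrite !inE => /orP[]/eqP ->; apply/mem_core_letters.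
Qed.

(** The given representatives are replaced by those of a Schreier transversal. *)
Lemma core_rank_base H V w : is_subgroup H -> covers_core H -> core_vertices H V ->
  w != [::] -> cyc_reduced w -> H (of_word w) ->
  exists n (b : 'I_n -> free_group X), is_basis b H /\
    \sum_(g <- V) (source_excess H g + sink_excess H g) + 2 = n.*2.
Proof.
move=> sH cov CV w0 cw Hw; have [t [tH tE tP]] := schreier_transversal sH.
have [uV injV coverV Vcore] := CV.
have tI g : t (t g) = t g by apply/tE/tH.
have tU g k : t g = t k -> H (g * k^-1).
  by move=> gk; apply: (coset_trans sH (cosetC sH (tH g))); rewrite gk; apply: tH.
have [||||n [b [bH e]]] := basis_of_core sH tH tE tP w0 cw Hw (V := map t V) (D := core_letters H).
- by rewrite map_inj_in_uniq // => g k gV kV /tU; apply: injV.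
- move=> g; split=> [/mapP[k kV ->]|[tg [a ga]]].
    split; first exact: tI.
    by have [a ka] := Vcore k kV; exists a; apply: core_edge_coset (tH k) ka.
  have [k kV gk] := coverV g a ga; apply/mapP; exists k => //.
  by rewrite -tg; apply: tE.
- exact: uniq_core_letters.
- by move=> g a; apply: mem_core_letters.
exists n, b; split=> //.
move: e; rewrite big_map size_map doubleD.
have -> : \sum_(g <- V) size (core_letters H (t g)) =
    \sum_(g <- V) (degree_out H g + degree_in H g).
  apply: eq_bigr => g _; rewrite size_core_letters.
  by have [-> ->] := degree_coset sH (tH g).
by rewrite sum_core_degree // addnAC => /addIn.
Qed.

(** A conjugation moves the base point into the core. It changes neither the
    rank nor the degrees. *)
Lemma core_rank H V : is_subgroup H -> covers_core H -> core_vertices H V ->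
  H <> [set 1] -> exists n, rank H = n%:Z%:E /\
    \sum_(g <- V) (source_excess H g + sink_excess H g) + 2 = n.*2.
Proof.
move=> sH cov CV H1; have [h Hh h1] : exists2 h, H h & h <> 1.
  apply: contrapT => nh; apply: H1; apply/seteqP; split=> [h Hh|_ ->]; last exact: sub1.
  by apply: contrapT => h1; apply: nh; exists h.
have [r [a [w cw Hw]]] := exists_core_edge sH Hh h1.
pose H' := conj_sub H r; have sH' : is_subgroup H' := conj_subgroup r sH.
have cE g : core_edge H' g = core_edge H (r * g).
  by apply/predeqP => c; apply: conj_core_edge.
have [uV injV coverV Vcore] := CV.
have dE g : (degree_out H' (r^-1 * g) = degree_out H g) * (degree_in H' (r^-1 * g) = degree_in H g).
  by split; apply: eq_count => x; rewrite cE mulVKg.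
have [||//|//|//|n [b [bH e]]] := @core_rank_base H' [seq r^-1 * g | g <- V] (a :: w) sH'.
- by move=> g c; rewrite cE; apply: cov.
- split.
  + by rewrite map_inj_uniq //; apply: mulgI.
  + move=> _ _ /mapP[g gV ->] /mapP[k kV ->]; rewrite /H' /conj_sub /mkset invgM invgK.
    by rewrite !mulgA mulgV mul1g mulgK => gk; congr (_ * _); apply: injV.
  + move=> g c; rewrite cE => /coverV[k kV gk]; exists (r^-1 * k).
      by apply/mapP; exists k.
    by rewrite /H' /conj_sub /mkset invgM invgK !mulgA mulgK.
  + move=> _ /mapP[g gV ->]; have [c gc] := Vcore g gV; exists c.
    by rewrite cE mulVKg.
exists n; split; first exact: rank_basis (conj_basis bH).
rewrite -e big_map; congr (_ + _); apply: eq_bigr => g _.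
by rewrite /source_excess /sink_excess !dE.
Qed.

End RankFormula.
(** * Finiteness of the core *)

Section FinitelyGenerated.
Variable X : Type.
Implicit Types (H K : set (free_group X)) (g : free_group X).

Lemma traverses_mul_word H g u w h a :
  traverses H g (mul_word u w) h a -> traverses H g (u ++ w) h a.
Proof.
elim: u g => //= b u IH g.
have red v : traverses H g (cons_reduce b v) h a -> traverses H g (b :: v) h a.
  case: v => // c v; rewrite /cons_reduce; case: eqVneq => // -> T.
  by right; right; rewrite fg_letterV mulgK.
by move=> /red[]; [left|right; apply: IH].
Qed.

(** The elements of H whose path stays on the paths of the generators form a
    subgroup, because the reduction of a path meets no new edge. *)
Lemma generated_traverses H (s : seq (free_group X)) h g a :
  H = smallest (@is_subgroup _) [set` s] -> is_subgroup H ->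
  H h -> traverses H 1 (word h) g a ->
  exists2 z, z \in s ++ [seq z^-1 | z <- s] & traverses H 1 (word z) g a.
Proof.
move=> Hs sH; set s' := s ++ _.
pose S g a := exists2 z, z \in s' & traverses H 1 (word z) g a.
have sub_s z : z \in s -> H z by rewrite Hs => zs; apply: sub_gen_smallest.
have s'V z : z \in s' -> H z /\ z^-1 \in s'.
  rewrite mem_cat => /orP[zs|/mapP[y ys ->]].
    by split; [apply: sub_s | rewrite mem_cat map_f ?orbT].
  by rewrite invgK mem_cat ys; split=> //; apply: subV => //; apply: sub_s.
have trV k h' b : H k -> traverses H 1 (word k) h' b ->
    traverses H 1 (word k^-1) (h' * fg_letter b) (inv_letter b).
  move=> Hk /traverses_inv; apply: traverses_coset => //.
    by rewrite wordK !mul1g; apply: subV.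
  by rewrite mulgV; apply: sub1.
have SV h' b : S h' b -> S (h' * fg_letter b) (inv_letter b).
  by case=> z /s'V[Hz zs] T; exists z^-1 => //; apply: trV.
pose N := [set h | H h /\ forall g a, traverses H 1 (word h) g a -> S g a].
suff : H `<=` N by move=> /[apply] -[_]; apply.
rewrite {1}Hs; apply: smallest_sub => [|z zs]; last first.
  by split=> [|h' b T]; [apply: sub_s | exists z => //; rewrite mem_cat zs].
apply: is_subgroupP => [|x y [Hx Sx] [Hy Sy]]; first by split=> //; apply: sub1.
split=> [|h' b]; first by apply: subM => //; apply: subV.
rewrite wordM => /traverses_mul_word/traverses_cat[/Sx //|].
rewrite mul1g wordK => T.
have {}T : traverses H 1 (word y^-1) h' b.
  apply: traverses_coset T => //; last by rewrite mulgV; apply: sub1.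
  by rewrite mul1g; apply: subV.
have := trV _ _ _ (subV sH Hy) T; rewrite invgK => /Sy/SV.
by rewrite fg_letterV mulgK inv_letterK.
Qed.

(** A list of representatives meeting all vertices of the core suffices: a
    transversal selects one in each coset. *)
Lemma core_vertices_of_cover H (V0 : seq (free_group X)) : is_subgroup H ->
  (forall g a, core_edge H g a -> exists2 k, k \in V0 & H (g * k^-1)) ->
  exists V, core_vertices H V.
Proof.
move=> sH cover; have [t [tH tE _]] := schreier_transversal sH.
have tU g k : t g = t k -> H (g * k^-1).
  by move=> gk; apply: (coset_trans sH (cosetC sH (tH g))); rewrite gk; apply: tH.
exists (undup [seq t k | k <- V0 & `[< exists a, core_edge H k a >]]); split.
- exact: undup_uniq.
- move=> g k; rewrite !mem_undup => /mapP[g' _ ->] /mapP[k' _ ->] gk.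
  by have := tE _ _ gk; rewrite !(tE _ _ (tH _)).
- move=> g a ga; have [k kV gk] := cover g a ga; exists (t k).
    rewrite mem_undup; apply/mapP; exists k => //; rewrite mem_filter kV andbT.
    by apply/asboolP; exists a; apply: core_edge_coset (cosetC sH gk) ga.
  by apply: (coset_trans sH gk); apply: cosetC.
- move=> k; rewrite mem_undup => /mapP[k']; rewrite mem_filter.
  move=> /andP[/asboolP[a ka] _] ->; exists a.
  by apply: core_edge_coset ka => //; apply: tH.
Qed.

Lemma fg_core_finite H : is_subgroup H -> finitely_generated H ->
  (exists V, core_vertices H V) /\ exists L, covers_core L H.
Proof.
move=> sH [s Hs]; set s' := s ++ [seq z^-1 | z <- s].
have tr g a : core_edge H g a -> exists2 z, z \in s' & traverses H 1 (word z) g a.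
  by move=> /(core_sub_based sH)[w [rw Hw T]]; apply: (generated_traverses Hs sH Hw); rewrite of_wordK.
split; last first.
  exists [seq a.1 | a <- flatten [seq word z | z <- s']] => g a /tr[z zs].
  case/traversesP => u [w [e _]]; apply: map_f; apply/flattenP.
  by exists (word z); [apply: map_f | rewrite e mem_cat mem_head orbT].
apply: (@core_vertices_of_cover H
  [seq of_word (take i (word z)) | z <- s', i <- iota 0 (size (word z))]) => // g a /tr[z zs].
case/traversesP => u [w [e]]; rewrite mul1g => Hu; exists (of_word u); last exact: cosetC.
apply/allpairsPdep; exists z, (size u); split=> //.
  by rewrite mem_iota e size_cat /= addnS ltnS leq_addr.
by rewrite e take_size_cat.
Qed.

Lemma is_subgroupI H K : is_subgroup H -> is_subgroup K -> is_subgroup (H `&` K).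
Proof.
move=> sH sK; apply: is_subgroupP => [|x y [Hx Kx] [Hy Ky]].
  by split; apply: sub1.
by split; apply: subM => //; apply: subV.
Qed.

Lemma core_edgeI H K g a : core_edge (H `&` K) g a -> core_edge H g a /\ core_edge K g a.
Proof. by case=> w cw [Hw Kw]; split; exists w. Qed.

(** A coset of H /\ K is determined by the cosets of H and of K that contain it,
    and the latter range over finite lists. *)
Lemma core_verticesI H K VH VK : is_subgroup H -> is_subgroup K ->
  core_vertices H VH -> core_vertices K VK ->
  exists V, core_vertices (H `&` K) V.
Proof.
move=> sH sK [_ _ covH _] [_ _ covK _].
pose z (u w : free_group X) := xget 1 [set z | H (z * u^-1) /\ K (z * w^-1)].
apply: (@core_vertices_of_cover _ [seq z u w | u <- VH, w <- VK]).
  exact: is_subgroupI.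
move=> g a /core_edgeI[/covH[u uV gu] /covK[w wV gw]].
have [Hz Kz] : [set z | H (z * u^-1) /\ K (z * w^-1)] (z u w).
  by apply: xgetPex; exists g.
exists (z u w); first exact: allpairs_f.
by split; [apply: (coset_trans sH gu) | apply: (coset_trans sK gw)]; apply: cosetC.
Qed.

End FinitelyGenerated.

(** * The core of an intersection *)

Section Intersection.
Variable X : Type.
Implicit Types (H K : set (free_group X)) (g : free_group X).

(** The cosets of H /\ K embed in the pairs of cosets of H and of K. *)
Lemma sum_inter_le H K (V VH VK : seq (free_group X)) (F f1 f2 : free_group X -> nat) :
  is_subgroup H -> is_subgroup K -> core_vertices (H `&` K) V ->
  core_vertices H VH -> core_vertices K VK ->
  (forall g u w, H (g * u^-1) -> K (g * w^-1) -> F g <= (f1 u * f2 w)%N) ->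
  \sum_(g <- V) F g <= ((\sum_(u <- VH) f1 u) * (\sum_(w <- VK) f2 w))%N.
Proof.
move=> sH sK [uV injV _ Vcore] [uVH _ covH _] [uVK _ covK _] le.
pose uof g := xget 1 [set u | u \in VH /\ H (g * u^-1)].
pose wof g := xget 1 [set w | w \in VK /\ K (g * w^-1)].
have uofP g : g \in V -> uof g \in VH /\ H (g * (uof g)^-1).
  move=> /Vcore[a /core_edgeI[/covH[u uVu gu] _]].
  by apply: (xgetPex 1 (P := [set u | u \in VH /\ H (g * u^-1)])); exists u.
have wofP g : g \in V -> wof g \in VK /\ K (g * (wof g)^-1).
  move=> /Vcore[a /core_edgeI[_ /covK[w wV gw]]].
  by apply: (xgetPex 1 (P := [set w | w \in VK /\ K (g * w^-1)])); exists w.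
rewrite big_distrlr /= -(big_allpairs (F := fun e => (f1 e.1 * f2 e.2)%N)).
apply: (@leq_trans (\sum_(e <- [seq (uof g, wof g) | g <- V]) (f1 e.1 * f2 e.2)%N)).
  rewrite big_map big_seq [X in _ <= X]big_seq; apply: leq_sum => g gV.
  by apply: le; [case: (uofP g gV) | case: (wofP g gV)].
apply: uniq_sub_le_big => //; first by move=> x y; apply: leq_addr.
- rewrite map_inj_in_uniq // => g k gV kV [eu ew]; apply: injV => //; split.
    apply: (coset_trans sH (proj2 (uofP g gV))); rewrite eu.
    by apply: cosetC => //; case: (uofP k kV).
  apply: (coset_trans sK (proj2 (wofP g gV))); rewrite ew.
  by apply: cosetC => //; case: (wofP k kV).
- by apply: allpairs_uniq => // -[? ?] [? ?] _ _ [-> ->].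
- move=> _ /mapP[g gV ->]; apply: allpairs_f.
    by case: (uofP g gV).
  by case: (wofP g gV).
Qed.

(** If the left-hand side is positive, so are both factors, and each of them is at
    least as large. *)
Lemma excess_leM p q p1 q1 p2 q2 : p <= p1 -> p <= p2 -> q <= q1 -> q <= q2 ->
  excess p q <= (excess p1 q1 * excess p2 q2)%N.
Proof.
have mono p' q' : p <= p' -> q <= q' -> excess p q <= excess p' q'.
  by rewrite /excess => pp qq; apply/leq_sub2r/leq_add => //; case: (q) q' qq => [|?] [|?].
move=> pp1 pp2 qq1 qq2; case e : (excess p q) => [//|k].
have := mono _ _ pp1 qq1; rewrite e => le1; apply: (leq_trans le1).
by apply: leq_pmulr; apply: leq_trans (mono _ _ pp2 qq2); rewrite e.
Qed.

Variable L : seq {classic X}.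

Lemma degreeI H K g u w : is_subgroup H -> is_subgroup K ->
  H (g * u^-1) -> K (g * w^-1) ->
  [/\ degree_out L (H `&` K) g <= degree_out L H u,
      degree_out L (H `&` K) g <= degree_out L K w,
      degree_in L (H `&` K) g <= degree_in L H u &
      degree_in L (H `&` K) g <= degree_in L K w].
Proof.
move=> sH sK gu gw.
have [<- <-] := degree_coset L sH gu; have [<- <-] := degree_coset L sK gw.
by split; apply: sub_count => x /asboolP/core_edgeI[? ?]; apply/asboolP.
Qed.

End Intersection.

(** * The core of the image under bar *)

Section BarCore.
Variable X : Type.
Implicit Types (H K : set (free_group X)) (g : free_group X).

Lemma bar1 : bar (1 : free_group X) = 1.
Proof. exact: fg_lift1. Qed.

Lemma barV g : bar g^-1 = (bar g)^-1.
Proof. exact: fg_liftV. Qed.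

Lemma bar_letter (a : letter X) : bar (fg_letter a) = fg_letter (inv_letter a).
Proof. by case: a => x []; rewrite /fg_letter /= ?barV bar_gen ?invgK. Qed.

Lemma bar_of_word (w : seq (letter X)) :
  bar (of_word w) = of_word (map (@inv_letter X) w).
Proof.
elim: w => [|a w IH]; first by rewrite /= !of_word_nil bar1.
by rewrite /= !of_word_cons barM bar_letter IH.
Qed.

Lemma bar_image H g : (bar @` H) g = H (bar g).
Proof.
apply/propext; split=> [[h Hh <-]|Hg]; first by rewrite barK.
by exists (bar g) => //; rewrite barK.
Qed.

Lemma bar_subgroup H : is_subgroup H -> is_subgroup (bar @` H).
Proof.
move=> sH; apply: is_subgroupP => [|x y]; rewrite !bar_image ?bar1; first exact: sub1.
by move=> Hx Hy; rewrite barM barV; apply: subM => //; apply: subV.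
Qed.

Lemma bar_core_edge H g a :
  core_edge (bar @` H) (bar g) a <-> core_edge H g (inv_letter a).
Proof.
have cyc (w : seq (letter X)) : cyc_reduced w -> cyc_reduced (map (@inv_letter X) w).
  rewrite /cyc_reduced cycle_map; apply: sub_cycle => b c /=.
  by apply: contraNN => /eqP/(can_inj (@inv_letterK X)) ->.
split=> -[w cw Hw]; exists (map (@inv_letter X) w).
- exact: cyc cw.
- move: Hw; rewrite bar_image !barM barV barK bar_of_word /=.
  by [].
- by have := cyc _ cw; rewrite /= inv_letterK.
- rewrite bar_image !barM barV barK bar_of_word /= -map_comp map_id_in // => b _ /=.
  exact: inv_letterK.
Qed.

Lemma bar_covers_core L H : covers_core L H -> covers_core L (bar @` H).
Proof. by move=> cov g a; rewrite -[g]barK => /bar_core_edge/cov. Qed.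

(** Replacing each letter by its inverse exchanges outgoing and incoming edges. *)
Lemma bar_degree L H g :
  degree_out L (bar @` H) (bar g) = degree_in L H g /\
  degree_in L (bar @` H) (bar g) = degree_out L H g.
Proof.
by split; apply: eq_count => x; apply: asbool_equiv_eq; apply: bar_core_edge.
Qed.

Lemma bar_core_vertices H V : core_vertices H V ->
  core_vertices (bar @` H) (map bar V).
Proof.
case=> uV injV covV Vcore; split.
- by rewrite map_inj_uniq //; apply: can_inj (@barK X).
- move=> _ _ /mapP[g gV ->] /mapP[k kV ->]; rewrite bar_image barM barV !barK.
  by move=> /(injV _ _ gV kV) ->.
- move=> g a; rewrite -[g]barK => /bar_core_edge/covV[k kV gk].
  by exists (bar k); [apply: map_f | rewrite bar_image barM barV !barK].
- move=> _ /mapP[g gV ->]; have [a ga] := Vcore g gV; exists (inv_letter a).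
  by apply/bar_core_edge; rewrite inv_letterK.
Qed.

End BarCore.

(** * The two pairs *)

(** The two products belong to the vertices over p and over q of the fibre
    product. The 2 on the right also covers a trivial intersection. *)
Lemma rank_inter_bound (X : Type) (L : seq {classic X}) (H K : set (free_group X)) VH VK :
  uniq L -> is_subgroup H -> is_subgroup K -> covers_core L H ->
  core_vertices H VH -> core_vertices K VK ->
  exists n, rank (H `&` K) = n%:Z%:E /\
   (n.*2 <= 2 + (\sum_(u <- VH) source_excess L H u) * (\sum_(w <- VK) source_excess L K w)
     + (\sum_(u <- VH) sink_excess L H u) * (\sum_(w <- VK) sink_excess L K w))%N.
Proof.
move=> uL sH sK cov CH CK; have sHK := is_subgroupI sH sK.
have [->|nt] := pselect (H `&` K = [set 1]); first by exists 0; rewrite rank_trivial.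
have [V CV] := core_verticesI sH sK CH CK.
have [n [rn en]] : exists n, rank (H `&` K) = n%:Z%:E /\
    \sum_(g <- V) (source_excess L (H `&` K) g + sink_excess L (H `&` K) g) + 2 = n.*2.
  by apply: core_rank => // g a /core_edgeI[/cov].
exists n; split=> //; rewrite -en big_split addnC -addnA leq_add2l; apply: leq_add;
  apply: (sum_inter_le sH sK CV CH CK) => g u w gu gw;
  have [o1 o2 i1 i2] := degreeI L sH sK gu gw; exact: excess_leM.
Qed.

Theorem theorem2 (X : Type) (H K : set (free_group X)) :
  is_subgroup H -> is_subgroup K ->
  finitely_generated H -> finitely_generated K ->
  H <> [set 1%g] -> K <> [set 1%g] ->
  (rank (H `&` K) - 1 <= (rank H - 1) * (rank K - 1))%E
  \/ (rank ((bar @` H) `&` K) - 1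
        <= (rank (bar @` H) - 1) * (rank K - 1))%E.
Proof.
move=> sH sK fH fK H1 K1.
have [[VH CH] [LH cH]] := fg_core_finite sH fH.
have [[VK CK] [LK cK]] := fg_core_finite sK fK.
pose L := undup (LH ++ LK); have uL : uniq L by apply: undup_uniq.
have covH : covers_core L H by move=> g a /cH; rewrite mem_undup mem_cat => ->.
have covK : covers_core L K by move=> g a /cK; rewrite mem_undup mem_cat orbC => ->.
have sB := bar_subgroup sH; have CB := bar_core_vertices CH.
have B1 : bar @` H <> [set 1].
  move=> B1; apply: H1; apply/seteqP; split=> [h Hh|_ ->]; last exact: sub1.
  have : (bar @` H) (bar h) by exists h.
  by rewrite B1 /= -[RHS]bar1 => /(can_inj (@barK X)).
have [h [rH eH]] := core_rank uL sH covH CH H1.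
have [k [rK eK]] := core_rank uL sK covK CK K1.
have [b [rB eB]] := core_rank uL sB (bar_covers_core covH) CB B1.
have [n1 [r1 le1]] := rank_inter_bound uL sH sK covH CH CK.
have [n2 [r2 le2]] := rank_inter_bound uL sB sK (bar_covers_core covH) CB CK.
have swap g : source_excess L (bar @` H) (bar g) = sink_excess L H g /\
    sink_excess L (bar @` H) (bar g) = source_excess L H g.
  by rewrite /source_excess /sink_excess; have [-> ->] := bar_degree L H g.
have sumB : \sum_(u <- map bar VH) source_excess L (bar @` H) u = \sum_(u <- VH) sink_excess L H u.
  by rewrite big_map; apply: eq_bigr => g _; case: (swap g).
have sumB' : \sum_(u <- map bar VH) sink_excess L (bar @` H) u = \sum_(u <- VH) source_excess L H u.
  by rewrite big_map; apply: eq_bigr => g _; case: (swap g).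
move: eH eK eB le1 le2; rewrite !big_split /= sumB sumB' rH rK rB r1 r2.
move: (\sum_(u <- VH) source_excess L H u) (\sum_(u <- VH) sink_excess L H u) => p q.
move: (\sum_(u <- VK) source_excess L K u) (\sum_(u <- VK) sink_excess L K u) => p' q'.
rewrite -!EFinB -!EFinM !lee_fin => eH eK eB le1 le2.
have AB : ((p * p' + q * q') + (q * p' + p * q') = (p + q) * (p' + q'))%N by lia.
case: h eH rH => [|h] eH rH; first by lia.
case: k eK rK => [|k] eK rK; first by lia.
have eb : b = h.+1 by lia.
have ep : (p + q = h.*2)%N by lia.
have ep' : (p' + q' = k.*2)%N by lia.
have eh (m : nat) : (m.+1%:Z - 1 = m :> int)%R by lia.
rewrite ep ep' in AB; rewrite eb !eh -PoszM.
(* One of the two bounds is at most half of their sum. *)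
have [le|lt] := leqP (p * p' + q * q') (q * p' + p * q'); [left|right].
  have : (n1.*2 <= 2 + (h * k).*2)%N by lia.
  lia.
have : (n2.*2 <= 2 + (h * k).*2)%N by lia.
lia.
Qed.
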